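(* There exist constants $c>0$ and $n_0$ such that for every $n\ge n_0$ there exists a graph $G$ on $n$ vertices with at least $c\,n\frac{\log n}{\log\log n}$ edges whose separation dimension is at most $4$.
   Context: For points $x,y\in\mathbb{R}^d$, let $b(x,y)$ denote the (closed) axis-parallel box spanned by $x$ and $y$, i.e. the smallest set $\prod_{i=1}^d[a_i,b_i]$ containing both. The separation dimension of a graph $G$ is the smallest $d$ for which there is a map $\phi:V(G)\to\mathbb{R}^d$ such that whenever $\{x,y\}$ and $\{x',y'\}$ are disjoint edges of $G$ (no common endpoint), the boxes $b(\phi(x),\phi(y))$ and $b(\phi(x'),\phi(y'))$ are disjoint. *)

(* Defs.v *)
From HB Require Import structures.
From mathcomp Require Import all_boot all_order all_algebra.
From mathcomp Require Import boolp classical_sets reals exp.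

Set Implicit Arguments.
Unset Strict Implicit.
Unset Printing Implicit Defensive.

Import Order.TTheory GRing.Theory Num.Theory.
Local Open Scope classical_set_scope.
Local Open Scope ring_scope.

Record sgraph (V : finType) := SGraph {
  adj :> rel V;
  adj_sym : symmetric adj;
  adj_irrefl : irreflexive adj }.

Definition edges (V : finType) (G : sgraph V) : {set {set V}} :=
  [set e : {set V} | [exists x, exists y, G x y && (e == [set x; y]%SET)]]%SET.

(* a <= b is not required; it holds for every nonempty box. *)
Definition box (R : realType) (d : nat) (a b : 'rV[R]_d) : set 'rV[R]_d :=
  [set z | forall i, a 0 i <= z 0 i <= b 0 i].

Definition span_box (R : realType) (d : nat) (x y : 'rV[R]_d) :
    set 'rV[R]_d :=
  smallest [set B | exists a b, B = box a b] [set x; y].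

(* The intersection defining [span_box] is itself a box. *)
Lemma span_boxE (R : realType) (d : nat) (x y : 'rV[R]_d) :
  span_box x y = box (\row_i Num.min (x 0 i) (y 0 i))
                     (\row_i Num.max (x 0 i) (y 0 i)).
Proof.
rewrite eqEsubset; split=> z.
  apply; split; first by do 2 eexists.
  by move=> _ [->|->] i; rewrite !mxE ge_min le_max lexx ?orbT.
move=> zxy B [[a [b ->]] sub] i.
have /andP[ax xb] := sub x (or_introl erefl) i.
have /andP[ay yb] := sub y (or_intror erefl) i.
have := zxy i; rewrite !mxE => /andP[mz zM]; apply/andP; split.
  by apply: le_trans mz; rewrite le_min ax ay.
by apply: le_trans zM _; rewrite ge_max xb yb.
Qed.

Definition separating (R : realType) (V : finType) (G : sgraph V) (d : nat)
    (phi : V -> 'rV[R]_d) : Prop :=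
  forall x y x' y' : V, G x y -> G x' y' ->
    ([set x; y] :&: [set x'; y'] = finset.set0)%SET ->
    span_box (phi x) (phi y) `&` span_box (phi x') (phi y') = set0.

Definition separable_in (R : realType) (V : finType) (G : sgraph V)
    (d : nat) : bool :=
  `[< exists phi : V -> 'rV[R]_d, separating G phi >].

(* One coordinate for each vertex subset S, equal to the indicator of S. *)
Lemma separable_in_ex (R : realType) (V : finType) (G : sgraph V) :
  exists d, separable_in R G d.
Proof.
exists #|{: {set V}}|; apply/asboolP.
exists (fun v => \row_i (v \in (enum_val i : {set V}))%:R) => x y x' y' _ _ dis.
rewrite !span_boxE -subset0 => z [zxy zxy'] /=.
have dF u : u \in [set x'; y']%SET -> (u \in [set x; y]%SET) = false.
  move=> uP; apply/negbTE/negP => uQ.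
  by have := finset.in_set0 u; rewrite -dis finset.in_setI uP uQ.
have := zxy (enum_rank [set x; y]%SET).
have := zxy' (enum_rank [set x; y]%SET).
rewrite !mxE enum_rankK set21 set22 !dF ?set21 ?set22 //=.
rewrite !minxx !maxxx => /andP[_ z0] /andP[z1 _].
by have := le_trans z1 z0; rewrite ler10.
Qed.

Definition sepdim (R : realType) (V : finType) (G : sgraph V) : nat :=
  ex_minn (separable_in_ex R G).

(* Main.v *)
Require Import Defs.
From mathcomp Require Import all_boot all_order all_algebra.
From mathcomp Require Import boolp classical_sets reals exp.
From mathcomp Require Import zify lra.

(* For a bipartite graph of points and rectangles in the plane, send the point
   (x, y) to (-x, x, -y, y) and the rectangle [a1, b1] x [a2, b2] to
   (-a1, b1, -a2, b2): incidence becomes the coordinatewise order of R^4, and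
   the boxes spanned by the incidences (p, B) and (p', B') meet only if p lies
   in B' and p' in B.  So the incidence graph has separation dimension at most 4
   as soon as it contains no K_{2,2}.
   Take the points (m, rev m) for m < t k^k, where rev reverses the k lowest
   base-k digits of m.  Fixing all digits but the j-th, j < k, cuts out a
   rectangle; two such rectangles share at most one point, there are as many
   rectangles as points, and each point lies in k of them.  With k the largest
   integer such that 2 k^k <= n, and t = n / (2 k^k), this gives about n k / 4
   edges, and k is of order ln n / ln ln n. *)

Import Order.TTheory GRing.Theory Num.Theory.
Local Open Scope ring_scope.

(** * Graphs obtained from an asymmetric relation *)

Section OrientedGraphs.
Variables (V : finType) (r : rel V).
Hypothesis r_asym : forall x y, r x y -> ~~ r y x.

Lemma symmetrize_sym : symmetric (fun x y => r x y || r y x).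
Proof. by move=> x y; rewrite orbC. Qed.

Lemma symmetrize_irrefl : irreflexive (fun x y => r x y || r y x).
Proof.
by move=> x; rewrite orbb; apply/negP => rxx; move: (r_asym _ _ rxx); rewrite rxx.
Qed.

Definition symmetrize : sgraph V := SGraph symmetrize_sym symmetrize_irrefl.

(** By asymmetry an unordered pair carries at most one orientation, so forgetting the order of the
    pairs [f e] identifies none of them. *)
Lemma card_edges_symmetrize (E : finType) (f : E -> V * V) :
  injective f -> (forall e, r (f e).1 (f e).2) ->
  (#|E| <= #|edges symmetrize|)%N.
Proof.
move=> f_inj rf; pose g e : {set V} := [set (f e).1; (f e).2]%SET.
have g_inj : injective g.
  move=> e e' /setP eq_g; apply: f_inj.
  have := rf e'; have := rf e; move: eq_g; rewrite {}/g.
  case: (f e) (f e') => [x y] [x' y'] /= eq_g rxy rxy'.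
  have := eq_g y; have := eq_g x; have := eq_g x'; have := eq_g y'.
  rewrite !inE !eqxx !orbT /= => Ey' Ex' /esym Ex /esym Ey.
  have [eq_x|ne_x] := eqVneq x x'.
    subst x'; case/orP: Ey => /eqP eq_y; last by rewrite eq_y.
    by subst y; move: (r_asym _ _ rxy); rewrite rxy.
  move: Ex; rewrite (negPf ne_x) /= => /eqP eq_xy'; subst y'.
  case/orP: Ey => /eqP eq_y; subst y.
    by move: (r_asym _ _ rxy); rewrite rxy'.
  by move: (r_asym _ _ rxy); rewrite rxy.
rewrite -(card_imset predT g_inj).
apply/subset_leq_card/fintype.subsetP => _ /imsetP[e _ ->].
rewrite inE; apply/existsP; exists (f e).1; apply/existsP; exists (f e).2.
by rewrite /= rf /=.
Qed.

(* The boxes [phi x, phi y] and [phi x', phi y'] meet only if phi x <= phi y'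
   and phi x' <= phi y. *)
Lemma separating_symmetrize (R : realType) (d : nat) (phi : V -> 'rV[R]_d) :
  (forall x y, r x y -> forall i, phi x 0 i <= phi y 0 i) ->
  (forall x y x' y', r x y -> r x' y' ->
     (forall i, phi x 0 i <= phi y' 0 i) -> r x y') ->
  (forall x y x' y', r x y -> r x y' -> r x' y -> r x' y' -> x = x' \/ y = y') ->
  separating symmetrize phi.
Proof.
move=> r_le le_r K22_free.
have spanC x y : span_box (phi x) (phi y) = span_box (phi y) (phi x).
  congr smallest; apply/funext => z; apply/propext.
  by split; case; [right|left|right|left].
have sep x y x' y' : r x y -> r x' y' ->
    ([set x; y] :&: [set x'; y'] = finset.set0)%SET ->
    (span_box (phi x) (phi y) `&` span_box (phi x') (phi y') = set0)%classic.
  move=> rxy rxy' dis; rewrite -subset0 => z [].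
  rewrite !span_boxE => zxy zxy'.
  have le1 i : phi x 0 i <= z 0 i.
    by have /andP[] := zxy i; rewrite !mxE min_l ?r_le.
  have le2 i : z 0 i <= phi y 0 i.
    by have /andP[] := zxy i; rewrite !mxE max_r ?r_le.
  have le3 i : phi x' 0 i <= z 0 i.
    by have /andP[] := zxy' i; rewrite !mxE min_l ?r_le.
  have le4 i : z 0 i <= phi y' 0 i.
    by have /andP[] := zxy' i; rewrite !mxE max_r ?r_le.
  have rx_y' : r x y' by apply: (le_r x y x' y') => // i; exact: le_trans (le4 i).
  have rx'_y : r x' y by apply: (le_r x' y' x y) => // i; exact: le_trans (le2 i).
  case: (K22_free x y x' y') => // eq.
    by have /setP/(_ x) := dis; rewrite !inE eq eqxx.
  by have /setP/(_ y) := dis; rewrite !inE eq eqxx !orbT.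
move=> x y x' y' /orP[] rxy /orP[] rxy' dis.
- exact: sep.
- by rewrite (spanC x'); apply: sep; rewrite // [X in _ :&: X]finset.setUC.
- by rewrite (spanC x); apply: sep; rewrite // [X in X :&: _]finset.setUC.
- rewrite (spanC x) (spanC x'); apply: sep => //.
  by rewrite [X in X :&: _]finset.setUC [X in _ :&: X]finset.setUC.
Qed.

End OrientedGraphs.

Lemma sepdim_le (R : realType) (V : finType) (G : sgraph V) (d : nat)
    (phi : V -> 'rV[R]_d) :
  separating G phi -> (sepdim R G <= d)%N.
Proof.
move=> sepG; rewrite /sepdim; case: ex_minnP => m _ min_m.
by apply: min_m; apply/asboolP; exists phi.
Qed.

(** * Digit reversal in base [b] *)

Fixpoint digit_rev (b k m : nat) : nat :=
  if k is k'.+1 then (m %% b * b ^ k' + digit_rev b k' (m %/ b))%N else 0%N.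

Lemma digit_rev_lt (b k m : nat) : (0 < b)%N -> (digit_rev b k m < b ^ k)%N.
Proof.
move=> b0; elim: k m => //= k IH m.
have := IH (m %/ b)%N; have : (m %% b < b)%N by rewrite ltn_pmod.
rewrite expnS; set x := (m %% b)%N; set y := digit_rev _ _ _; nia.
Qed.

(* The j leading digits of the reversal determine the j trailing digits. *)
Lemma digit_rev_div_inj (b k j m m' : nat) : (0 < b)%N -> (j <= k)%N ->
  (digit_rev b k m %/ b ^ (k - j) = digit_rev b k m' %/ b ^ (k - j))%N ->
  (m = m' %[mod b ^ j])%N.
Proof.
move=> b0; elim: j k m m' => [|j IH] [|k] m m' //.
- by rewrite !modn1.
- by rewrite !modn1.
rewrite ltnS subSS /= => jk.
have E : (b ^ k = b ^ j * b ^ (k - j))%N by rewrite -expnD subnKC.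
have d0 : (0 < b ^ (k - j))%N by rewrite expn_gt0 b0.
have lt_rev x : (digit_rev b k x %/ b ^ (k - j) < b ^ j)%N.
  by rewrite ltn_divLR // -E digit_rev_lt.
(* Both sides become a lowest digit times [b ^ j] plus a remainder below [b ^ j]: the lowest digits
   agree, and the remainders feed the induction. *)
rewrite E !mulnA !divnMDl // => eq.
have := congr1 (modn^~ (b ^ j)%N) eq; have := congr1 (divn^~ (b ^ j)%N) eq.
rewrite /= !divnMDl ?expn_gt0 ?b0 // !(divn_small (lt_rev _)) !addn0.
rewrite !modnMDl !(modn_small (lt_rev _)) => eq_low eq_rev.
have := IH _ _ _ jk eq_rev; rewrite !modn_divl -expnSr => eq_high.
have low x : (x %% b ^ j.+1 %% b = x %% b)%N by rewrite modn_dvdm // expnS dvdn_mulr.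
by rewrite (divn_eq (m %% _) b) (divn_eq (m' %% _) b) !low eq_low eq_high.
Qed.

(** Turns a condition on leading digits into a side of a rectangle. *)
Lemma divn_eq_interval (m d q : nat) : (0 < d)%N ->
  (m %/ d == q)%N = (q * d <= m <= q * d + d.-1)%N.
Proof.
move=> d0; rewrite eqn_leq andbC leq_divRL // -[(m %/ d <= q)%N]ltnS ltn_divLR //.
by congr (_ && _); rewrite mulSn; lia.
Qed.

(** * Incidences of points and digit lines *)

Section PointsAndLines.
Variables b k t : nat.
Hypotheses (b_gt0 : (0 < b)%N).
Local Open Scope nat_scope.

(* The line w fixes every digit of a point but the one at position line_dir w:
   line_col w is the number formed by the digits above that position, and
   line_row w the reversal of those below it. *)
Definition line_per_dir := t * b ^ k.-1.
Definition line_dir w := w %/ line_per_dir.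
Definition line_col w := w %% line_per_dir %/ b ^ line_dir w.
Definition line_row w := w %% line_per_dir %% b ^ line_dir w.

Definition incident p w :=
  [&& line_dir w < k, p %/ b ^ (line_dir w).+1 == line_col w
    & digit_rev b k p %/ b ^ (k - line_dir w) == line_row w].

(** For directions [j < j'], the line of direction [j] fixes all digits above [j] and the other one
    all digits below [j'], so together they determine the point. For equal directions, a common
    point determines column and row, hence the line. *)
Lemma incident_K22_free p p' w w' :
  incident p w -> incident p w' -> incident p' w -> incident p' w' ->
  p = p' \/ w = w'.
Proof.
have digits j j' : j < j' -> j' <= k -> p %/ b ^ j.+1 = p' %/ b ^ j.+1 ->
    digit_rev b k p %/ b ^ (k - j') = digit_rev b k p' %/ b ^ (k - j') -> p = p'.
  move=> lt_jj' le_j'k eq_high eq_rev.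
  have eq_low := digit_rev_div_inj _ _ _ _ _ b_gt0 le_j'k eq_rev.
  have low x : x %% b ^ j' %% b ^ j.+1 = x %% b ^ j.+1.
    by rewrite modn_dvdm // dvdn_exp2l.
  by rewrite (divn_eq p (b ^ j.+1)) (divn_eq p' (b ^ j.+1)) -(low p) -(low p') eq_low eq_high.
rewrite /incident => /and3P[dw /eqP c1 /eqP r1] /and3P[dw' /eqP c2 /eqP r2].
move=> /and3P[_ /eqP c3 /eqP r3] /and3P[_ /eqP c4 /eqP r4].
have [lt|lt|eq_dir] := ltngtP (line_dir w) (line_dir w').
- by left; apply: (digits _ _ lt (ltnW dw')); congruence.
- by left; apply: (digits _ _ lt (ltnW dw)); congruence.
right; have eq_mod : w %% line_per_dir = w' %% line_per_dir.
  rewrite (divn_eq (w %% _) (b ^ line_dir w)) (divn_eq (w' %% _) (b ^ line_dir w')).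
  rewrite -/(line_col w) -/(line_col w') -/(line_row w) -/(line_row w').
  by congruence.
rewrite (divn_eq w line_per_dir) (divn_eq w' line_per_dir) eq_mod.
by rewrite -/(line_dir w) -/(line_dir w') eq_dir.
Qed.

(** Lines are numbered direction by direction, and within a direction by column, then row. *)
Definition line_through p j :=
  j * line_per_dir + (p %/ b ^ j.+1 * b ^ j + digit_rev b k p %/ b ^ (k - j)).

Lemma line_through_lt p j : p < t * b ^ k -> j < k ->
  p %/ b ^ j.+1 * b ^ j + digit_rev b k p %/ b ^ (k - j) < line_per_dir.
Proof.
move=> pT jk.
have E : t * b ^ k = t * b ^ (k - j.+1) * b ^ j.+1 by rewrite -mulnA -expnD subnK.
have E' : line_per_dir = t * b ^ (k - j.+1) * b ^ j.
  by rewrite /line_per_dir -mulnA -expnD; congr (_ * _ ^ _); lia.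
rewrite E -ltn_divLR ?expn_gt0 ?b_gt0 // in pT.
have lt_rev : digit_rev b k p %/ b ^ (k - j) < b ^ j.
  by rewrite ltn_divLR ?expn_gt0 ?b_gt0 // -expnD subnKC ?digit_rev_lt // ltnW.
by rewrite E'; nia.
Qed.

Lemma line_dir_through p j : p < t * b ^ k -> j < k -> line_dir (line_through p j) = j.
Proof.
move=> pT jk; have lt := line_through_lt _ _ pT jk.
by rewrite /line_dir divnMDl ?(divn_small lt) ?addn0 // (leq_trans _ lt).
Qed.

Lemma incident_through p j : p < t * b ^ k -> j < k -> incident p (line_through p j).
Proof.
move=> pT jk; have lt := line_through_lt _ _ pT jk.
have lt_rev : digit_rev b k p %/ b ^ (k - j) < b ^ j.
  by rewrite ltn_divLR ?expn_gt0 ?b_gt0 // -expnD subnKC ?digit_rev_lt // ltnW.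
rewrite /incident /line_col /line_row line_dir_through // jk.
rewrite modnMDl (modn_small lt) modnMDl (modn_small lt_rev) eqxx andbT.
by rewrite divnMDl ?expn_gt0 ?b_gt0 // (divn_small lt_rev) addn0 eqxx.
Qed.

End PointsAndLines.

(** * The incidence graph and its embedding in dimension 4 *)

Lemma dense_sepdim4 (R : realType) (k t n : nat) :
  (0 < k)%N -> (2 * (t * k ^ k) <= n)%N ->
  exists G : sgraph 'I_n, (t * k ^ k * k <= #|edges G|)%N /\ (sepdim R G <= 4)%N.
Proof.
move=> k_gt0 le_n; set T := (t * k ^ k)%N.
(* The vertices v < T are the points; T + w is the line w. *)
pose r (x y : 'I_n) := [&& x < T, T <= y & incident k k t x (y - T)]%N.
have r_asym x y : r x y -> ~~ r y x.
  by move=> /and3P[_ Ty _]; rewrite /r [(y < T)%N]ltnNge Ty.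
exists (symmetrize _ _ r_asym); split.
  have through_lt (pj : 'I_T * 'I_k) : (T + line_through k k t pj.1 pj.2 < n)%N.
    case: pj => p j /=.
    have := line_through_lt _ _ _ k_gt0 _ _ (ltn_ord p) (ltn_ord j).
    (* Base [k] makes the number of lines over all [k] directions equal to the number of points. *)
    have E : (T = k * line_per_dir k k t)%N.
      by rewrite /T /line_per_dir mulnCA -expnS prednK.
    have := ltn_ord j; rewrite /line_through; move: le_n; rewrite -/T.
    set a := (_ + _)%N; set L := line_per_dir _ _ _ in E *; nia.
  have point_lt (pj : 'I_T * 'I_k) : (pj.1 < n)%N.
    by have := ltn_ord pj.1; move: le_n; rewrite -/T; lia.
  rewrite -[(T * k)%N](_ : #|{: 'I_T * 'I_k}| = _); last by rewrite card_prod !card_ord.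
  pose f pj := (Ordinal (point_lt pj), Ordinal (through_lt pj)).
  apply: (card_edges_symmetrize _ _ _ _ f).
    move=> [p j] [p' j'] [eq_p /addnI eq_l].
    have eq_j := congr1 (line_dir k k t) eq_l.
    rewrite !line_dir_through // in eq_j.
    by congr pair; exact: val_inj.
  by move=> [p j]; rewrite /r /= ltn_ord leq_addr addKn incident_through.
(* The rectangle of a line is [[X, X'] x [Y, Y']]; a point is a degenerate rectangle. Ends are
   inclusive, whence the predecessors of [width] and [height]. *)
pose width v := (k ^ (line_dir k k t (v - T)).+1)%N.
pose height v := (k ^ (k - line_dir k k t (v - T)))%N.
pose X v := (if v < T then v else line_col k k t (v - T) * width v)%N.
pose X' v := (if v < T then v else X v + (width v).-1)%N.
pose Y v :=
  (if v < T then digit_rev k k v else line_row k k t (v - T) * height v)%N.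
pose Y' v := (if v < T then digit_rev k k v else Y v + (height v).-1)%N.
pose phi (v : 'I_n) : 'rV[R]_4 :=
  \row_i [:: - (X v)%:R; (X' v)%:R; - (Y v)%:R; (Y' v)%:R]`_i.
have phiP (x y : 'I_n) : (x < T)%N -> (T <= y)%N ->
   reflect (forall i, phi x 0 i <= phi y 0 i)
    [&& x %/ width y == line_col k k t (y - T)
      & digit_rev k k x %/ height y == line_row k k t (y - T)]%N.
  move=> xT Ty; rewrite !divn_eq_interval ?expn_gt0 ?k_gt0 //.
  apply: (iffP andP) => [[/andP[X1 X2] /andP[Y1 Y2]] i | le_phi].
    rewrite !mxE /X' /Y' /X /Y xT [(y < T)%N]ltnNge Ty /=.
    by case: i => [[|[|[|[|]]]] ?] //=; rewrite ?lerN2 ler_nat.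
  have := le_phi 0; have := le_phi 1; have := le_phi 2; have := le_phi 3.
  rewrite !mxE /X' /Y' /X /Y xT [(y < T)%N]ltnNge Ty /= ?lerN2 !ler_nat.
  by move=> -> -> -> ->.
apply: (sepdim_le _ _ _ _ phi); apply: separating_symmetrize.
- by move=> x y /and3P[xT Ty /andP[_ inc]]; exact/phiP.
- move=> x y x' y' /and3P[xT _ _] /and3P[_ Ty' /andP[dir _]] /phiP le_phi.
  by rewrite /r xT Ty' /= /incident dir le_phi.
- move=> x y x' y' /and3P[_ Ty i1] /and3P[_ Ty' i2] /and3P[_ _ i3] /and3P[_ _ i4].
  case: (incident_K22_free _ _ _ k_gt0 _ _ _ _ i1 i2 i3 i4) => eq; [left|right].
    exact: val_inj.
  by apply: val_inj; rewrite /= -(subnK Ty) eq subnK.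
Qed.

(** * Asymptotics and choice of parameters *)

(** From below, [ln n >= k ln k >= k], so [ln (ln n) >= ln k]. From above, [k + 1 <= k ^ 2] gives
    [ln n <= ln 2 + 2 (k + 1) ln k <= 5 k ln k]. *)
Lemma ln_div_lnln_le (R : realType) (k n : nat) : (4 <= k)%N ->
  (2 * k ^ k <= n)%N -> (n < 2 * k.+1 ^ k.+1)%N ->
  ln n%:R / ln (ln n%:R) <= 5 * k%:R :> R.
Proof.
move=> k4 le_n lt_n.
have k0 : 0 < k%:R :> R by rewrite ltr0n; lia.
have ln_nat_le (a b : nat) : (0 < a)%N -> (a <= b)%N -> ln a%:R <= ln b%:R :> R.
  by move=> a0 ab; rewrite ler_ln ?posrE ?ltr0n ?ler_nat //; lia.
have ln_natM (a b : nat) : (0 < a)%N -> (0 < b)%N -> ln (a * b)%:R = ln a%:R + ln b%:R :> R.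
  by move=> a0 b0; rewrite natrM lnM ?posrE ?ltr0n.
have ln_natX (a c : nat) : (0 < a)%N -> ln (a ^ c)%:R = c%:R * ln a%:R :> R.
  by move=> a0; rewrite natrX lnXn ?ltr0n // mulr_natl.
(* This is [ln (1 + x) <= x] at [x = - 1/2]. *)
have ln2 : 2^-1 <= ln 2 :> R.
  have := @le_ln1Dx R (- 2^-1); rewrite (_ : 1 + - 2^-1 = 2^-1); last by lra.
  rewrite lnV ?posrE //.
  by move=> H; rewrite -lerN2; apply: H; lra.
have lnk1 : 1 <= ln k%:R :> R.
  by apply: le_trans (ln_nat_le 4 _ _ k4) => //; rewrite (ln_natM 2 2)%N //; lra.
have lnn : k%:R * ln k%:R <= ln n%:R :> R.
  by rewrite -ln_natX; [apply: ln_nat_le; rewrite ?expn_gt0|]; lia.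
have lnn_k : k%:R <= ln n%:R :> R by nra.
have lnlnn : ln k%:R <= ln (ln n%:R) :> R.
  by rewrite ler_ln ?posrE //; lra.
rewrite ler_pdivrMr; last by lra.
have : ln n%:R <= ln 2 + k.+1%:R * ln k.+1%:R :> R.
  by rewrite -ln_natX // -(ln_natM 2) ?expn_gt0 //; apply: ln_nat_le; lia.
have lnk2 : ln k.+1%:R <= 2 * ln k%:R :> R.
  by rewrite -(ln_natX _ 2) ; [apply: ln_nat_le; nia|lia].
have ln2k : ln 2 <= ln k%:R :> R by apply: (ln_nat_le 2); lia.
have k41 : 4 <= k%:R :> R by rewrite (ler_nat _ 4).
have : k.+1%:R * ln k.+1%:R <= (k%:R + 1) * (2 * ln k%:R) :> R.
  by rewrite natr1 ler_wpM2l.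
have : k%:R * ln k%:R <= k%:R * ln (ln n%:R) :> R by rewrite ler_wpM2l // ltW.
have : ln k%:R <= k%:R * ln k%:R :> R by rewrite ler_peMl //; lra.
lra.
Qed.

Theorem theorem4 (R : realType) :
  exists c : R, 0 < c /\ exists n0 : nat, forall n : nat, (n0 <= n)%N ->
    exists G : sgraph 'I_n,
      c * n%:R * (ln n%:R / ln (ln n%:R)) <= #|edges G|%:R :> R /\
      (sepdim R G <= 4)%N.
Proof.
(* 20 = 4 * 5, from [n <= 4 t k^k] and the bound [5 k] on the ratio of logarithms. *)
exists 20^-1; split; first by lra.
(* This threshold forces [k >= 4]. *)
exists (2 * 4 ^ 4)%N => n n_large.
have exk : exists k, (2 * k ^ k <= n)%N by exists 4.
have bounded k : (2 * k ^ k <= n)%N -> (k <= n)%N.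
  case: k => // k; apply: leq_trans; rewrite expnS.
  have : (0 < k.+1 ^ k)%N by rewrite expn_gt0.
  nia.
have [k le_n max_k] := ex_maxnP exk bounded.
have k4 : (4 <= k)%N by apply: max_k.
have lt_n : (n < 2 * k.+1 ^ k.+1)%N.
  by rewrite ltnNge; apply/negP => /max_k; rewrite ltnn.
pose t := (n %/ (2 * k ^ k))%N.
have kk0 : (0 < 2 * k ^ k)%N by rewrite muln_gt0 expn_gt0 (leq_trans _ k4).
have t0 : (0 < t)%N by rewrite divn_gt0.
have [||G [edges_G sepdim_G]] := dense_sepdim4 R k t n.
- exact: leq_trans k4.
- by rewrite mulnCA leq_divM.
exists G; split => //.
(* [n < (t + 1) * 2 k^k], and [t + 1 <= 2 t]. *)
have nT : (n <= 4 * (t * k ^ k))%N.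
  have := ltn_ceil n kk0; rewrite -/t.
  by move: t0; clear; set B := (k ^ k)%N; nia.
have := ln_div_lnln_le R _ _ k4 le_n lt_n.
set q := ln _ / _ => q_le.
apply: le_trans (_ : (t * k ^ k * k)%:R <= _); last by rewrite ler_nat.
have : n%:R * q <= n%:R * (5 * k%:R) :> R by rewrite ler_wpM2l.
have : n%:R * k%:R <= (4 * (t * k ^ k) * k)%:R :> R.
  by rewrite -natrM ler_nat leq_mul2r nT orbT.
by rewrite -mulnA natrM -mulrA; lra.
Qed.
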